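(* Let $G$ be a Lie group with linear growth. Let $(g,\tilde g)$ be any pair of Wick rotated metrics on $G$ and let $h$ be the Clairaut metric associated to them (i.e. the Clairaut metric of $g$ constructed from a common orthonormal basis of $\mathfrak{g}$). Then there exist constants $a,b\ge 0$, $a>0$, such that $$\Vert v_p\Vert_h\ge\frac{\Vert v_p\Vert_{\tilde g}}{a+b\,d_{\tilde g}(1,p)}$$ for all $p$ in the identity component of $G$ and all $v_p\in T_pG$, where $\Vert\cdot\Vert_h$ and $\Vert\cdot\Vert_{\tilde g}$ are the pointwise norms of $h$ and $\tilde g$ and $d_{\tilde g}$ is the distance of $\tilde g$.
   Context: A semi-Riemannian metric is a smooth non-degenerate symmetric 2-tensor field of constant (arbitrary) signature. Let $G$ be a Lie group with unit $1$, identity component $G_0$ and Lie algebra $\mathfrak{g}=T_1G$. Linear growth: for a left-invariant Riemannian metric $g_R$ on $G$, put $r(p)=d_R(1,p)$ for $p\in G_0$, where $d_R$ is the distance induced by $g_R$. $G$ has (at most) linear growth if there exist a left-invariant Riemannian metric $g_R$ on $G$, a Euclidean scalar product on $\mathfrak{g}$ with norm $\Vert\cdot\Vert$, and real constants $a,b$ (with $a+b\,r(p)>0$) such that $\frac{\Vert u\Vert}{a+b\,r(p)}\le \Vert \mathrm{Ad}_p(u)\Vert\le (a+b\,r(p))\Vert u\Vert$ for every $p\in G_0$ and $u\in\mathfrak{g}$. Wick rotation: let $g$ be a left-invariant semi-Riemannian metric on $G$ and let $(e_i)$ be a basis of $\mathfrak{g}$ that is orthonormal for $g_1$, i.e. $g_1(e_i,e_j)=\epsilon_i\delta_{ij}$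 with $\epsilon_i\in\{\pm1\}$. Let $\tilde g$ be the left-invariant Riemannian metric with $\tilde g_1(e_i,e_j)=\delta_{ij}$. Then $g$ and $\tilde g$ are said to be Wick rotated metrics, with common orthonormal basis $(e_i)$. Clairaut metric: given a left-invariant semi-Riemannian metric $g$ and a basis $(e_i)$ of $\mathfrak{g}$, let $Y_i$ be the right-invariant vector field with $Y_i(1)=e_i$ and $\omega^i=g(Y_i,\cdot)$; the Clairaut metric associated to $g$ from $(e_i)$ is the Riemannian metric $h=\sum_i\omega^i\otimes\omega^i$. *)

(* Defs.v *)
From HB Require Import structures.
From mathcomp Require Import all_boot all_order all_algebra.
From mathcomp Require Import all_classical all_reals all_analysis.

Set Implicit Arguments.
Unset Strict Implicit.
Unset Printing Implicit Defensive.

Import Order.TTheory GRing.Theory Num.Theory.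
Import numFieldNormedType.Exports.

Local Open Scope classical_set_scope.
Local Open Scope ring_scope.

(* For U open in a finite-dimensional space V: f is C^k on U.  Only the germs
   of f at the points of U matter. *)
Fixpoint Ck (R : realType) (V W : normedModType R) (k : nat)
    (U : set V) (f : V -> W) : Prop :=
  match k with
  | 0 => forall x, U x -> {for x, continuous f}
  | k'.+1 => (forall x, U x -> differentiable f x) /\
             (forall v, Ck k' U ('D_v f))
  end.

Definition smooth_on (R : realType) (V W : normedModType R)
    (U : set V) (f : V -> W) : Prop := forall k, Ck k U f.

(* The values of chart_fun outside chart_dom, and those of chart_inv outside
   chart_img, are irrelevant. *)
Record chart (R : realType) (n : nat) (M : topologicalType) := Chart {
  chart_dom : set M;
  chart_fun :> M -> 'rV[R]_n;
  chart_inv : 'rV[R]_n -> M;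
  chart_img := chart_fun @` chart_dom;
  chart_dom_open : open chart_dom;
  chart_img_open : open chart_img;
  chart_funK : forall p, chart_dom p -> chart_inv (chart_fun p) = p;
  chart_fun_continuous : forall p, chart_dom p -> {for p, continuous chart_fun};
  chart_inv_continuous : forall x, chart_img x -> {for x, continuous chart_inv}
}.

(* chart_at selects a preferred chart around each point; see tangent below. *)
HB.mixin Record isSmoothManifold (R : realType) (n : nat) M
    of Topological M := {
  atlas : set (chart R n M);
  chart_at : M -> chart R n M;
  chart_at_atlas : forall p, atlas (chart_at p);
  chart_at_dom : forall p, chart_dom (chart_at p) p;
  atlas_compatible : forall phi psi : chart R n M, atlas phi -> atlas psi ->
    smooth_on (phi @` (chart_dom phi `&` chart_dom psi)) (psi \o chart_inv phi);
  manifold_hausdorff : hausdorff_space M;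
  manifold_second_countable : @second_countable M
}.

#[short(type="smoothManifoldType")]
HB.structure Definition SmoothManifold (R : realType) (n : nat) :=
  {M of Topological M & isSmoothManifold R n M}.

HB.mixin Record isLieGroup (R : realType) (n : nat) G
    of SmoothManifold R n G & Group G := {
  mulg_continuous : continuous (fun pq : G * G => (pq.1 * pq.2)%g);
  mulg_smooth : forall phi psi chi : chart R n G,
    @atlas R n G phi -> @atlas R n G psi -> @atlas R n G chi ->
    smooth_on
      [set xy : 'rV[R]_n * 'rV[R]_n | [/\ chart_img phi xy.1,
         chart_img psi xy.2 &
         chart_dom chi (chart_inv phi xy.1 * chart_inv psi xy.2)%g]]
      (fun xy => chi (chart_inv phi xy.1 * chart_inv psi xy.2)%g);
  invg_continuous : continuous (fun p : G => (p^-1)%g);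
  invg_smooth : forall phi chi : chart R n G,
    @atlas R n G phi -> @atlas R n G chi ->
    smooth_on
      [set x | chart_img phi x /\ chart_dom chi ((chart_inv phi x)^-1)%g]
      (fun x => chi ((chart_inv phi x)^-1)%g)
}.

#[short(type="lieGroupType")]
HB.structure Definition LieGroup (R : realType) (n : nat) :=
  {G of SmoothManifold R n G & Group G & isLieGroup R n G}.

(* The tangent space at p is R^n: a tangent vector is represented by its
   components in the preferred chart at p. *)
Definition tangent (R : realType) (n : nat) (M : smoothManifoldType R n)
  (p : M) : Type := 'rV[R]_n.

Section Manifold.
Variables (R : realType) (n : nat) (M : smoothManifoldType R n).
Local Notation at_ p := (@chart_at R n M p).
Local Notation atl := (@atlas R n M).

(* The differential of F at p, from the tangent space at p to that at F p. *)
Definition tmap (F : M -> M) (p : M) : tangent p -> tangent (F p) :=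
  'd (at_ (F p) \o F \o chart_inv (at_ p)) (at_ p p).

(* The tangent vector at p whose components in the chart phi are v. *)
Definition from_chart (phi : chart R n M) (p : M) (v : 'rV[R]_n) : tangent p :=
  'd (at_ p \o chart_inv phi) (phi p) v.

Definition smooth_curve_on (I : set R) (c : R -> M) : Prop :=
  (forall t, I t -> {for t, continuous c}) /\
  (forall phi, atl phi -> smooth_on (I `&` c @^-1` chart_dom phi) (phi \o c)).

Definition velocity (c : R -> M) (t : R) : tangent (c t) :=
  derive1 (at_ (c t) \o c : R -> 'rV[R]_n) t.

(* s lists the subdivision points other than 0; on each closed piece c is the
   restriction of a curve that is smooth on an open neighbourhood. *)
Definition piecewise_smooth (c : R -> M) : Prop :=
  {within `[0, 1], continuous c} /\
  exists s : seq R,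
    [/\ path <%R 0 s, last 0 s = 1 &
      forall i, (i < size s)%N ->
        exists (I : set R) (c' : R -> M),
          [/\ open I, `[nth 0 (0 :: s) i, nth 0 s i] `<=` I,
              smooth_curve_on I c' &
              {in `[nth 0 (0 :: s) i, nth 0 s i], c =1 c'}]].

Definition tensor2 := forall p : M, tangent p -> tangent p -> R.

Definition bilinear_form (V : lmodType R) (B : V -> V -> R) : Prop :=
  (forall u, scalar (B u)) /\ (forall v, scalar (B ^~ v)).

(* e is an orthonormal basis for B with B e_i e_i = eps_i. *)
Definition orthonormal_basis (B : 'rV[R]_n -> 'rV[R]_n -> R)
    (e : n.-tuple 'rV[R]_n) (eps : 'I_n -> R) : Prop :=
  [/\ basis_of fullv e, forall i, eps i = 1 \/ eps i = -1 &
      forall i j, B (tnth e i) (tnth e j) = eps i *+ (i == j)].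

(* B has signature (s, n - s), s being the number of minus signs. *)
Definition has_index (B : 'rV[R]_n -> 'rV[R]_n -> R) (s : nat) : Prop :=
  (s <= n)%N /\ exists e, orthonormal_basis B e (fun i => (-1) ^+ (i < s)%N).

Definition smooth_tensor2 (g : tensor2) : Prop :=
  forall phi, atl phi -> forall u v : 'rV[R]_n,
    smooth_on (chart_img phi)
      (fun x => let p := chart_inv phi x in
        g p (from_chart phi p u) (from_chart phi p v)).

Definition semi_riemannian (g : tensor2) : Prop :=
  [/\ smooth_tensor2 g,
      forall p, @bilinear_form 'rV[R]_n (g p),
      forall p u v, g p u v = g p v u,
      forall p u, (forall v, g p u v = 0) -> u = 0 :> 'rV[R]_n &
      exists s, forall p, has_index (g p) s].

Definition positive_definite (B : 'rV[R]_n -> 'rV[R]_n -> R) : Prop :=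
  forall u, u != 0 -> 0 < B u u.

Definition riemannian (g : tensor2) : Prop :=
  semi_riemannian g /\ forall p, positive_definite (g p).

Definition tnorm (g : tensor2) (p : M) (v : tangent p) : R :=
  Num.sqrt (g p v v).

Definition curve_length (g : tensor2) (c : R -> M) : \bar R :=
  (\int[lebesgue_measure]_(t in `[0%R, 1%R]) (tnorm g (velocity c t))%:E)%E.

(* fine only makes the value real: it is finite when p and q lie in the same
   connected component, the only case in which dist is used. *)
Definition dist (g : tensor2) (p q : M) : R :=
  fine (ereal_inf [set curve_length g c | c in
    [set c : R -> M | [/\ piecewise_smooth c, c 0 = p & c 1 = q]]]).

End Manifold.

Section LieGroup.
Variables (R : realType) (n : nat) (G : lieGroupType R n).
Implicit Types g : tensor2 G.

Definition identity_component : set G := connected_component [set: G] 1%g.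

Definition lie_algebra : Type := tangent (1%g : G).

Definition left_invariant g : Prop :=
  forall p q (u v : tangent q),
    g (p * q)%g (tmap (fun x => p * x)%g u) (tmap (fun x => p * x)%g v) = g q u v.

(* Its values lie in the tangent space at p * 1 * p^-1 = 1. *)
Definition Ad (p : G) (u : lie_algebra) : lie_algebra :=
  tmap (fun x : G => p * x * p^-1)%g (u : tangent (1%g : G)).

(* The right-invariant vector field with value u at 1. *)
Definition right_invariant_field (u : lie_algebra) (p : G) : tangent p :=
  tmap (fun x : G => x * p)%g (u : tangent (1%g : G)).

Definition linear_growth : Prop :=
  exists gR, [/\ riemannian gR, left_invariant gR &
  exists B : 'rV[R]_n -> 'rV[R]_n -> R,
    [/\ bilinear_form B, forall u v, B u v = B v u, positive_definite B &
  exists a b : R, forall p, identity_component p ->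
    let r := dist gR 1%g p in
    let N u := Num.sqrt (B u u) in
    0 < a + b * r /\
    forall u : lie_algebra,
      N u / (a + b * r) <= N (Ad p u) /\ N (Ad p u) <= (a + b * r) * N u]].

Definition wick_rotated g g' (e : n.-tuple lie_algebra) : Prop :=
  [/\ semi_riemannian g, left_invariant g, riemannian g', left_invariant g' &
      (exists eps, orthonormal_basis (g 1%g) e eps) /\
      orthonormal_basis (g' 1%g) e (fun=> 1)].

Definition clairaut g (e : n.-tuple lie_algebra) : tensor2 G :=
  fun p u v => \sum_(i < n)
    g p (right_invariant_field (tnth e i) p) u *
    g p (right_invariant_field (tnth e i) p) v.

End LieGroup.

(* Main.v *)
Require Import Defs.
From HB Require Import structures.
From mathcomp Require Import all_boot all_order all_algebra.
From mathcomp Require Import all_classical all_reals all_analysis.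
From mathcomp Require Import ring lra.
Set Implicit Arguments.
Unset Strict Implicit.
Unset Printing Implicit Defensive.

Import Order.TTheory GRing.Theory Num.Theory.
Import numFieldNormedType.Exports.
Local Open Scope classical_set_scope.
Local Open Scope ring_scope.

(** Left translation by the inverse of p carries a vector v at p to a vector w
    of the Lie algebra, and left invariance reduces both norms to w: one has
    g'(v, v) = g'_1(w, w), while the right-invariant field with value e_i at 1
    is carried to Ad_{p^-1} e_i, so that the Clairaut metric gives
    h(v, v) = sum_i g_1(Ad_{p^-1} e_i, w)^2.

    As g_1(e_i, w) is, up to sign, the i-th coordinate of w,
    g'_1(w, w) = sum_i g_1(e_i, w)^2; this is where the two metrics having a
    common orthonormal basis matters.  Expanding Ad_p e_i = sum_j m_ij e_j and
    applying Ad_{p^-1} expresses e_i through the vectors Ad_{p^-1} e_j, hence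
    g_1(e_i, w) = sum_j m_ij g_1(Ad_{p^-1} e_j, w).  The Cauchy-Schwarz
    inequality then bounds g'(v, v) by h(v, v) times the squared Frobenius norm
    of Ad_p in the basis (lemma wick_norm_bound), and linear growth bounds that
    Frobenius norm by a constant multiple of a + b * r(p).

    The distance r in the growth condition belongs to another left-invariant
    metric, and the growth condition measures Ad_p with another scalar product.
    Any two inner products on a finite-dimensional space dominate each other
    (inner_product_dominates), so any two left-invariant Riemannian metrics
    have comparable norms, with a constant independent of the point, and
    comparable distances (dist_le).

    The geometric input is the chain rule for the differentials of left and
    right translations (tmap_comp), which yields that Ad_{p^-1} inverts Ad_p
    and that left translation turns right-invariant fields into Ad. *)

(** * Inner products on a finite-dimensional space *)

Lemma scalar_sum (R : realType) (V : lmodType R) (f : V -> R) (n : nat)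
    (a : 'I_n -> R) (u : 'I_n -> V) :
  scalar f -> f (\sum_i a i *: u i) = \sum_i a i * f (u i).
Proof.
move=> lf; pose M := GRing.isLinear.Build R V R _ f lf.
pose F : {scalar V} := HB.pack f M.
rewrite -[f]/(F : V -> R) linear_sum; apply: eq_bigr => i _.
by rewrite linearZ.
Qed.

Lemma scalar0 (R : realType) (V : lmodType R) (f : V -> R) :
  scalar f -> f 0 = 0.
Proof.
by move=> lf; have := lf (-1) 0 0; rewrite scaler0 addr0 mulN1r addNr.
Qed.

Section InnerProducts.
Variables (R : realType) (n : nat).
Implicit Types B : 'rV[R]_n -> 'rV[R]_n -> R.

Definition inner_product B :=
  [/\ bilinear_form B, forall u v, B u v = B v u & positive_definite B].

Lemma inner_product_ge0 B u : inner_product B -> 0 <= B u u.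
Proof.
move=> [[lB _] _ pB]; have [->|/pB/ltW//] := eqVneq u 0.
by rewrite (scalar0 (lB 0)).
Qed.

Lemma cauchy_schwarz B u v : inner_product B -> B u v ^+ 2 <= B u u * B v v.
Proof.
move=> iB; have [[lB rB] sB pB] := iB.
have [->|/pB Bu] := eqVneq u 0.
  by rewrite (scalar0 (rB v)) expr0n /= mulr_ge0// inner_product_ge0.
(* The component of v orthogonal to u has nonnegative square. *)
have := inner_product_ge0 (- (B u v / B u u) *: u + v) iB.
have rB' a x y z : B (a *: x + y) z = a * B x z + B y z by rewrite rB.
rewrite lB !rB' (sB v u).
set c := B u v; set d := B u u; set k := B v v => H.
have d0 : d != 0 by rewrite gt_eqF.
have -> : c ^+ 2 = d * k - d * (- (c / d) * (- (c / d) * d + c) +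
   (- (c / d) * c + k)) by field.
by rewrite gerBl mulr_ge0// ltW.
Qed.

(** By invertibility of the Gram matrix, a linear functional is the inner
    product with some vector, so that the Cauchy-Schwarz inequality applies. *)
Lemma functional_bound B (l : 'rV[R]_n -> R) :
  inner_product B -> scalar l ->
  exists C, forall v, l v ^+ 2 <= C * B v v.
Proof.
move=> iB ll; have [[lB rB] sB pB] := iB.
pose S : 'M[R]_n := \matrix_(i, j) B (delta_mx 0 i) (delta_mx 0 j).
have BS u v : B u v = \sum_j v 0 j * (u *m S) 0 j.
  rewrite [v in LHS]row_sum_delta (scalar_sum _ _ (lB u)).
  apply: eq_bigr => j _; congr (_ * _).
  rewrite [u in LHS]row_sum_delta (scalar_sum _ _ (rB _)) mxE.
  by apply: eq_bigr => i _; rewrite !mxE.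
(* A vector killed by S is orthogonal to every vector, in particular to itself. *)
have uS : S \in unitmx.
  rewrite -row_free_unit; apply: inj_row_free => v vS0.
  apply/eqP; apply: contraT => /pB; rewrite BS vS0.
  by rewrite big1 ?ltxx// => i _; rewrite mxE mulr0.
pose f := (\row_j l (delta_mx 0 j)) *m invmx S.
exists (B f f) => v; suff -> : l v = B f v by exact: cauchy_schwarz.
rewrite BS mulmxKV// [v in LHS]row_sum_delta (scalar_sum _ _ ll).
by apply: eq_bigr => j _; rewrite !mxE.
Qed.

(** Writing B1 u u = sum_i u_i * B1 e_i u in the standard basis, each summand is
    a product of two linear functionals of u, and functional_bound controls
    both. *)
Lemma inner_product_dominates B1 B2 :
  bilinear_form B1 -> inner_product B2 ->
  exists2 C, 0 < C & forall u, B1 u u <= C * B2 u u.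
Proof.
move=> [lB1 rB1] iB2.
have row_coord i : scalar (fun u : 'rV[R]_n => u 0 i).
  by move=> a u v; rewrite !mxE.
have /choice[c cP] : forall i, exists C, forall v : 'rV[R]_n,
    v 0 i ^+ 2 <= C * B2 v v.
  by move=> i; apply: functional_bound.
have /choice[d dP] : forall i, exists C, forall v : 'rV[R]_n,
    B1 (delta_mx 0 i) v ^+ 2 <= C * B2 v v.
  by move=> i; apply: functional_bound.
exists (`|\sum_i (c i + d i)| + 1) => [|u]; first by rewrite ltr_wpDl.
apply: (@le_trans _ _ (\sum_i (c i + d i) * B2 u u)).
  rewrite [X in B1 X u]row_sum_delta (scalar_sum _ _ (rB1 u)).
  apply: ler_sum => i _.
  have := cP i u; have := dP i u; rewrite mulrDl.
  set x := u 0 i; set y := B1 _ u => H1 H2.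
  have : 0 <= (x - y) ^+ 2 by exact: sqr_ge0.
  have : 0 <= x ^+ 2 by exact: sqr_ge0.
  have : 0 <= y ^+ 2 by exact: sqr_ge0.
  nra.
rewrite -mulr_suml ler_wpM2r ?inner_product_ge0//.
by rewrite (le_trans (ler_norm _))// lerDl.
Qed.

Lemma inner_product_dominates_norm B1 B2 :
  bilinear_form B1 -> inner_product B2 ->
  exists2 C, 0 < C &
    forall u, Num.sqrt (B1 u u) <= C * Num.sqrt (B2 u u).
Proof.
move=> bB1 iB2; have [C C0 CP] := inner_product_dominates bB1 iB2.
exists (Num.sqrt C) => [|u]; first by rewrite sqrtr_gt0.
by rewrite -sqrtrM ?ler_wsqrtr// ltW.
Qed.

End InnerProducts.

Lemma sum_mul_sqr_le (R : realType) (n : nat) (x y : 'I_n -> R) :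
  (\sum_i x i * y i) ^+ 2 <= (\sum_i x i ^+ 2) * (\sum_i y i ^+ 2).
Proof.
pose dot (u v : 'rV[R]_n) := \sum_i u 0 i * v 0 i.
have lin u : scalar (dot u).
  move=> a v w; rewrite /dot /= mulr_sumr -big_split/=; apply: eq_bigr => i _.
  by rewrite !mxE; ring.
have dotC u v : dot u v = dot v u.
  by apply: eq_bigr => i _; rewrite mulrC.
have idot : inner_product dot.
  split=> //; first split=> // v a u w; rewrite ?(dotC _ v) ?lin//.
  move=> u u0; rewrite lt_neqAle sumr_ge0 ?andbT; last first.
    by move=> i _; rewrite -expr2 sqr_ge0.
  apply: contra u0 => /eqP/esym/psumr_eq0P u0; apply/eqP/rowP => i.
  apply/eqP; rewrite mxE -sqrf_eq0 expr2; apply/eqP/u0 => // j _.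
  by rewrite -expr2 sqr_ge0.
have := cauchy_schwarz (\row_i x i) (\row_i y i) idot.
rewrite /dot; under eq_bigr do rewrite !mxE.
under [X in _ <= X * _ -> _]eq_bigr do rewrite mxE -expr2.
by under [X in _ <= _ * X -> _]eq_bigr do rewrite mxE -expr2.
Qed.

(** * Orthonormal bases *)

Section OrthonormalBases.
Variables (R : realType) (n : nat).
Implicit Types (B : 'rV[R]_n -> 'rV[R]_n -> R) (e : n.-tuple 'rV[R]_n).

Lemma orthonormal_decomp B e eps w : orthonormal_basis B e eps ->
  w = \sum_i coord e i w *: tnth e i.
Proof.
move=> [be _ _]; rewrite {1}(coord_basis be (memvf w)).
by apply: eq_bigr => i _; rewrite (tnth_nth 0).
Qed.

Lemma orthonormal_coord B e eps i w : bilinear_form B ->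
  orthonormal_basis B e eps -> B (tnth e i) w = eps i * coord e i w.
Proof.
move=> [lB _] oe; have [_ _ Be] := oe.
rewrite {1}(orthonormal_decomp w oe) (scalar_sum _ _ (lB _)) (bigD1 i)//= Be.
rewrite eqxx mulr1n mulrC big1 ?addr0// => j ji.
by rewrite Be eq_sym (negbTE ji) mulr0n mulr0.
Qed.

Lemma orthonormal_norm B e w : bilinear_form B ->
  orthonormal_basis B e (fun=> 1) -> B w w = \sum_i coord e i w ^+ 2.
Proof.
move=> bB oe; have [_ rB] := bB.
rewrite {1}(orthonormal_decomp w oe) (scalar_sum _ _ (rB w)).
by apply: eq_bigr => i _; rewrite (orthonormal_coord _ _ bB oe) mul1r expr2.
Qed.

(** With A' a right inverse of the linear map A, each basis vector e_i is a
    combination of the vectors A e_j whose coefficients are the coordinates of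
    A' e_i, and the Cauchy-Schwarz inequality applies to each B e_i w.  The first
    factor of the bound is the squared Frobenius norm of A', a substitute for the
    squared operator norm. *)
Lemma wick_norm_bound B B' e eps (A A' : 'rV[R]_n -> 'rV[R]_n) w :
  bilinear_form B -> bilinear_form B' ->
  orthonormal_basis B e eps -> orthonormal_basis B' e (fun=> 1) ->
  linear A -> cancel A' A ->
  B' w w <= (\sum_i B' (A' (tnth e i)) (A' (tnth e i))) *
            \sum_j B (A (tnth e j)) w ^+ 2.
Proof.
move=> bB bB' oe oe' lA A'K.
have Bei i : B (tnth e i) w =
    \sum_j coord e j (A' (tnth e i)) * B (A (tnth e j)) w.
  have lBA : scalar (fun u => B (A u) w).
    by move=> a u v; rewrite lA; case: bB => _ ->.
  by rewrite -(scalar_sum _ _ lBA) -(orthonormal_decomp _ oe') A'K.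
have -> : B' w w = \sum_i B (tnth e i) w ^+ 2.
  rewrite (orthonormal_norm _ bB' oe'); apply: eq_bigr => i _.
  rewrite (orthonormal_coord _ _ bB oe) exprMn.
  by have [_ /(_ i)[]-> _] := oe; rewrite ?sqrrN expr1n mul1r.
rewrite mulr_suml; apply: ler_sum => i _.
by rewrite Bei (orthonormal_norm _ bB' oe') sum_mul_sqr_le.
Qed.

End OrthonormalBases.

(** * Comparison of lengths and distances *)

Section IntegralScale.
Import HBNNSimple.

(** The integral of a nonnegative function is a supremum over the simple functions
    below it, and dividing by c maps those below f to simple functions below g.
    Arguing on simple functions makes the inequality available at once for the
    speed of any curve. *)
Lemma integral_le_scale (d : measure_display) (T : measurableType d)
    (R : realType) (mu : {measure set T -> \bar R}) (D : set T)
    (f g : T -> R) (c : R) :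
  0 < c -> (forall x, 0 <= f x) -> (forall x, 0 <= g x) ->
  (forall x, f x <= c * g x) ->
  (\int[mu]_(x in D) (f x)%:E <= c%:E * \int[mu]_(x in D) (g x)%:E)%E.
Proof.
move=> c0 f0 g0 fg.
rewrite !ge0_integralE; try by move=> x _; rewrite lee_fin.
apply/ge_ereal_sup => /= _ [h /= hf <-].
have ci0 : 0 <= c^-1 by rewrite invr_ge0 ltW.
pose k := scale_nnsfun h ci0.
have -> : sintegral mu h = (c%:E * sintegral mu k)%E.
  rewrite (_ : sintegral mu k = (c^-1)%:E * sintegral mu h)%E ?sintegralrM//.
  by rewrite muleA -EFinM mulfV ?gt_eqF// mul1e.
rewrite lee_pmul2l//; apply: ereal_sup_ubound; exists k => //= x.
have := hf x; rewrite /patch; case: ifP => _; rewrite !lee_fin => hx.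
  by rewrite ler_pdivrMl// (le_trans hx).
by rewrite mulr_ge0_le0.
Qed.

End IntegralScale.

Section Distances.
Variables (R : realType) (n : nat) (M : smoothManifoldType R n).
Implicit Types (g : tensor2 M).

Lemma riemannian_inner g p : riemannian g -> inner_product (g p).
Proof. by move=> [[_ bg sg _ _] pg]; split. Qed.

Let len g (p q : M) := ereal_inf [set curve_length g c | c in
    [set c : R -> M | [/\ piecewise_smooth c, c 0 = p & c 1 = q]]].

Let len_ge0 g p q : (0 <= len g p q)%E.
Proof.
apply: le_ereal_inf_tmp => _ [c _ <-]; apply: integral_ge0 => t _.
by rewrite lee_fin sqrtr_ge0.
Qed.

Let len_le g1 g2 C p q : 0 < C ->
  (forall x (v : tangent x), tnorm g1 v <= C * tnorm g2 v) ->
  (len g1 p q <= C%:E * len g2 p q)%E.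
Proof.
move=> C0 le12; rewrite -lee_pdivrMl//; apply: le_ereal_inf_tmp => _ [c cP <-].
rewrite lee_pdivrMl//; apply: (@le_trans _ _ (curve_length g1 c)).
  by apply: ereal_inf_lbound; exists c.
by apply: integral_le_scale => // t; rewrite sqrtr_ge0.
Qed.

Lemma dist_ge0 g p q : 0 <= dist g p q.
Proof. exact/fine_ge0/len_ge0. Qed.

(** As dist sends an infinite infimum of lengths to 0, an inequality between the
    infima does not by itself compare the values of dist; domination in both
    directions makes the two infima infinite together. *)
Lemma dist_le g1 g2 C1 C2 p q : 0 < C1 -> 0 < C2 ->
  (forall x (v : tangent x), tnorm g1 v <= C1 * tnorm g2 v) ->
  (forall x (v : tangent x), tnorm g2 v <= C2 * tnorm g1 v) ->
  dist g1 p q <= C1 * dist g2 p q.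
Proof.
move=> C10 C20 /(@len_le _ _ _ p q C10) + /(@len_le _ _ _ p q C20).
rewrite /dist -/(len g1 p q) -/(len g2 p q).
have := len_ge0 g1 p q; have := len_ge0 g2 p q.
case: (len g1 p q) (len g2 p q) => [a| |] [b| |]//= _ _ _ _.
by rewrite mulr0.
Qed.

End Distances.

(** * Differentials of maps between manifolds *)

Section NearEqual.
Variables (R : realType) (V W : normedModType R).

(** A composite of maps read in charts agrees with the composite of the chart
    expressions only near the point, hence this locality statement. *)
Lemma near_eq_diff (f k : V -> W) (x : V) :
  (\near x, f x = k x) -> differentiable f x ->
  differentiable k x /\ 'd k x = 'd f x :> (V -> W).
Proof.
move=> fk df; have fkx : f x = k x := nbhs_singleton fk.
have dfc := diff_continuous df.
have kE : k \o shift x = cst (k x) + 'd f x +o_ 0 id.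
  apply/eqaddoP => eps eps0; have /eqaddoP/(_ eps eps0) := diff_locally df.
  have : \forall y \near (0 : V), f (y + x) = k (y + x).
    by move: fk; rewrite (near_shift 0 x) subr0.
  apply: filterS2 => y /=; rewrite !fctE /= => <-.
  by rewrite fkx.
have dk : 'd k x = 'd f x :> (V -> W) by exact: diff_unique.
by split=> //; apply/diff_locallyP; rewrite dk.
Qed.

End NearEqual.

Section TangentMaps.
Variables (R : realType) (n : nat) (M : smoothManifoldType R n).
Local Notation at_ p := (@chart_at R n M p).

(** Continuity is a separate clause because the chart expression says nothing
    about F at points that F sends out of the domain of the chart at F p. *)
Definition differentiable_at (F : M -> M) (p : M) : Prop :=
  {for p, continuous F} /\
  differentiable (at_ (F p) \o F \o chart_inv (at_ p)) (at_ p p).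

Lemma chart_inv_at p : chart_inv (at_ p) (at_ p p) = p.
Proof. exact/chart_funK/chart_at_dom. Qed.

Lemma chart_img_nbhs p : nbhs (at_ p p) (chart_img (at_ p)).
Proof.
apply: open_nbhs_nbhs; split; first exact: chart_img_open.
by exists p => //; exact: chart_at_dom.
Qed.

Lemma chart_inv_at_cvg p : chart_inv (at_ p) @ at_ p p --> p.
Proof.
rewrite -[X in _ --> X]chart_inv_at; apply: chart_inv_continuous.
by exists p => //; exact: chart_at_dom.
Qed.

Lemma tmap_id p (u : tangent p) : tmap (@id M) u = u :> 'rV[R]_n.
Proof.
rewrite /tmap.
have ide : \forall x \near at_ p p,
    idfun x = (at_ p \o id \o chart_inv (at_ p)) x.
  apply: filterS (chart_img_nbhs p) => _ [q qp <-] /=.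
  by rewrite chart_funK.
have cid : continuous (idfun : 'rV[R]_n -> 'rV[R]_n) by move=> x; exact: cvg_id.
have [_ ->] := near_eq_diff ide (linear_differentiable _ cid).
by rewrite diff_lin.
Qed.

Lemma tmap_comp F K p : differentiable_at F p -> differentiable_at K (F p) ->
  differentiable_at (K \o F) p /\
  forall u : tangent p, tmap (K \o F) u = tmap K (tmap F u) :> 'rV[R]_n.
Proof.
move=> [cF dF] [cK dK].
set f := _ \o chart_inv _ in dF; set k := _ \o chart_inv _ in dK.
have fp : f (at_ p p) = at_ (F p) (F p) by rewrite /f /= chart_inv_at.
rewrite -fp in dK.
have kf : \forall x \near at_ p p, (k \o f) x =
   (at_ (K (F p)) \o (K \o F) \o chart_inv (at_ p)) x.
  have Fdom : \forall x \near at_ p p,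
      chart_dom (at_ (F p)) (F (chart_inv (at_ p) x)).
    have /cF/chart_inv_at_cvg// : nbhs (F p) (chart_dom (at_ (F p))).
    apply: open_nbhs_nbhs; split; first exact: chart_dom_open.
    exact: chart_at_dom.
  by apply: filterS Fdom => x Fx; rewrite /k /f /= chart_funK.
have [dKF KFE] := near_eq_diff kf (differentiable_comp dF dK).
split.
  split; last exact: dKF.
  exact: (cvg_comp _ _ cF cK).
move=> u; apply: (etrans (congr1 (@^~ u) KFE)).
apply: (etrans (congr1 (@^~ u) (diff_comp dF dK))).
by rewrite fp.
Qed.

End TangentMaps.

(** * Translations and the adjoint representation *)

Section LieGroups.
Variables (R : realType) (n : nat) (G : lieGroupType R n).
Local Notation at_ p := (@chart_at R n G p).

Lemma mul_differentiable (a b : G) : differentiable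
  (fun xy : 'rV[R]_n * 'rV[R]_n =>
    at_ (a * b)%g (chart_inv (at_ a) xy.1 * chart_inv (at_ b) xy.2)%g)
  (at_ a a, at_ b b).
Proof.
have [+ _] := mulg_smooth _ _ _ (chart_at_atlas a) (chart_at_atlas b)
  (chart_at_atlas (a * b)%g) 1%N.
apply; split => /=; first by exists a => //; exact: chart_at_dom.
  by exists b => //; exact: chart_at_dom.
by rewrite !chart_inv_at; exact: chart_at_dom.
Qed.

Lemma lmul_differentiable (a p : G) : differentiable_at (fun x => a * x)%g p.
Proof.
split.
  have := @mulg_continuous R n G (a, p).
  apply: (@continuous_comp _ _ _ (pair a) (fun pq : G * G => pq.1 * pq.2)%g).
  by apply: cvg_pair; [exact: cvg_cst|exact: cvg_id].
have -> : at_ (a * p)%g \o (fun x => a * x)%g \o chart_inv (at_ p) =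
  (fun xy : 'rV[R]_n * 'rV[R]_n =>
    at_ (a * p)%g (chart_inv (at_ a) xy.1 * chart_inv (at_ p) xy.2)%g) \o
  (fun x => (at_ a a, x)).
  by apply/funext => x /=; rewrite chart_inv_at.
apply: differentiable_comp; last exact: mul_differentiable.
by apply: differentiable_pair.
Qed.

Lemma rmul_differentiable (a p : G) : differentiable_at (fun x => x * a)%g p.
Proof.
split.
  have := @mulg_continuous R n G (p, a).
  apply: (@continuous_comp _ _ _ (pair^~ a) (fun pq : G * G => pq.1 * pq.2)%g).
  by apply: cvg_pair; [exact: cvg_id|exact: cvg_cst].
have -> : at_ (p * a)%g \o (fun x => x * a)%g \o chart_inv (at_ p) =
  (fun xy : 'rV[R]_n * 'rV[R]_n =>
    at_ (p * a)%g (chart_inv (at_ p) xy.1 * chart_inv (at_ a) xy.2)%g) \o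
  (fun x => (x, at_ a a)).
  by apply/funext => x /=; rewrite chart_inv_at.
apply: differentiable_comp; last exact: mul_differentiable.
by apply: differentiable_pair.
Qed.

Lemma conj_differentiable (p q : G) :
  differentiable_at (fun x => p * x * p^-1)%g q.
Proof.
by have [] := tmap_comp (lmul_differentiable p q) (rmul_differentiable p^-1%g _).
Qed.

Lemma Ad_inv (p : G) (u : lie_algebra G) : Ad p^-1%g (Ad p u) = u :> 'rV[R]_n.
Proof.
have [_ /(_ u)] := tmap_comp (conj_differentiable p 1%g)
  (conj_differentiable p^-1%g _).
have -> : (fun x : G => p^-1 * x * p^-1^-1)%g \o (fun x => p * x * p^-1)%g = id.
  by apply/funext => x /=; rewrite invgK !mulgA mulVg mul1g mulgVK.
by rewrite tmap_id mulg1 mulgV => /esym.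
Qed.

(** Right translation by p followed by left translation by its inverse is
    conjugation by the inverse of p. *)
Lemma left_transl_right_invariant_field (p : G) (u : lie_algebra G) :
  tmap (fun x => p^-1 * x)%g (right_invariant_field u p) = Ad p^-1%g u
  :> 'rV[R]_n.
Proof.
have [_ /(_ u)] := tmap_comp (rmul_differentiable p 1%g)
  (lmul_differentiable p^-1%g _).
have -> : (fun x : G => p^-1 * x)%g \o (fun x => x * p)%g =
    (fun x => p^-1 * x * p^-1^-1)%g.
  by apply/funext => x /=; rewrite invgK mulgA.
by rewrite /Ad => ->; rewrite mul1g.
Qed.

Lemma left_invariant_at1 (g : tensor2 G) (p : G) (u v : tangent p) :
  left_invariant g ->
  g p u v = g 1%g (tmap (fun x => p^-1 * x)%g u) (tmap (fun x => p^-1 * x)%g v).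
Proof.
move=> /(_ p^-1%g p u v) <-.
(* Both sides involve the vectors only through their components, so the base
   points p^-1 * p and 1 can be exchanged once these are generalized. *)
have e : (p^-1 * p = 1)%g by rewrite mulVg.
have : forall (q : G) (x y : 'rV[R]_n), q = 1%g -> g q x y = g 1%g x y.
  by move=> q x y ->.
exact.
Qed.

Lemma Ad_linear (p : G) : linear (Ad p : 'rV[R]_n -> 'rV[R]_n).
Proof. by move=> a u v; rewrite /Ad /tmap linearP. Qed.

(** Domination at the unit spreads to every point by left translation, with the
    same constant. *)
Lemma left_invariant_norm_dominates (g1 g2 : tensor2 G) :
  riemannian g1 -> riemannian g2 -> left_invariant g1 -> left_invariant g2 ->
  exists2 C, 0 < C & forall p (v : tangent p), tnorm g1 v <= C * tnorm g2 v.
Proof.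
move=> r1 r2 l1 l2.
have [b1 _ _] := riemannian_inner 1%g r1.
have [C C0 CP] := inner_product_dominates_norm b1 (riemannian_inner 1%g r2).
exists C => // p v; rewrite /tnorm.
by rewrite (left_invariant_at1 v v l1) (left_invariant_at1 v v l2).
Qed.

End LieGroups.

(** * The Clairaut metric under linear growth *)

Theorem lemma4p6 (R : realType) (n : nat) (G : lieGroupType R n)
  (g g' : tensor2 G) (e : n.-tuple (lie_algebra G)) :
  linear_growth G -> wick_rotated g g' e ->
  exists a b : R, [/\ 0 < a, 0 <= b &
    forall p : G, identity_component p -> forall v : tangent p,
      tnorm g' v / (a + b * dist g' 1%g p) <= tnorm (clairaut g e) v].
Proof.
move=> [gR [rR lR [B [bB sB pB [a0 [b0 growth]]]]]].
move=> [[_ bg _ _ _] lg rg' lg' [[eps oe] oe']].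
have bg' p : bilinear_form (g' p : 'rV[R]_n -> 'rV[R]_n -> R).
  by have [] := riemannian_inner p rg'.
have [C1 C10 le1] := left_invariant_norm_dominates rR rg' lR lg'.
have [C2 C20 le2] := left_invariant_norm_dominates rg' rR lg' lR.
have iB : inner_product B by split.
have [K K0 leK] := inner_product_dominates (bg' 1%g) iB.
(* (a0 + b0 * r)^2 * N2 will bound the squared Frobenius norm of Ad p, K being
   the price of passing from B to g' at 1. *)
pose N2 := \sum_i K * B (tnth e i) (tnth e i).
have N20 : 0 <= N2.
  by apply: sumr_ge0 => i _; rewrite mulr_ge0 ?inner_product_ge0// ltW.
pose L := Num.sqrt N2.
have L0 : 0 <= L by exact: sqrtr_ge0.
(* a0 and b0 may be negative, whence the absolute values, and L vanishes in
   dimension 0, whence the summand 1; C1 converts r into the distance of g'. *)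
exists (`|a0| * L + 1), (`|b0| * C1 * L); split.
- by rewrite ltr_wpDl// mulr_ge0.
- by rewrite !mulr_ge0// ltW.
move=> p Gp v.
have [] := growth p Gp; set r := dist gR _ _; set d := dist g' _ _.
set s := a0 + b0 * r => s0 Adp.
have d0 : 0 <= d by exact: dist_ge0.
have r0 : 0 <= r by exact: dist_ge0.
have rd : r <= C1 * d by exact: (dist_le 1%g p C10 C20 le1 le2).
have sL : s * L <= `|a0| * L + 1 + `|b0| * C1 * L * d.
  have : s <= `|a0| + `|b0| * (C1 * d).
    apply: lerD; first exact: ler_norm.
    exact: le_trans (ler_wpM2r r0 (ler_norm b0)) (ler_wpM2l (normr_ge0 b0) rd).
  nra.
rewrite ler_pdivrMr; last by rewrite ltr_wpDr ?ltr_wpDl ?mulr_ge0// ltW.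
have hE : clairaut g e v v = \sum_i
    g 1%g (Ad p^-1%g (tnth e i)) (tmap (fun x => p^-1 * x)%g v) ^+ 2.
  apply: eq_bigr => i _.
  by rewrite left_invariant_at1// left_transl_right_invariant_field -expr2.
have AdB u : B (Ad p u) (Ad p u) <= s ^+ 2 * B u u.
  have [_] := Adp u.
  have := inner_product_ge0 u iB; have := inner_product_ge0 (Ad p u) iB => x0 y0.
  rewrite -[X in _ -> X <= _](sqr_sqrtr x0) -[X in _ -> _ <= _ * X](sqr_sqrtr y0).
  rewrite -exprMn => H; rewrite lerXn2r ?nnegrE ?sqrtr_ge0//.
  by apply: mulr_ge0; [exact: ltW|exact: sqrtr_ge0].
have main : g' p v v <= s ^+ 2 * N2 * clairaut g e v v.
  rewrite (left_invariant_at1 v v lg').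
  apply: le_trans (wick_norm_bound _ (bg 1%g) (bg' 1%g) oe oe'
    (Ad_linear p^-1%g) (@Ad_inv _ _ _ p)) _.
  rewrite -hE ler_wpM2r//.
    by rewrite hE sumr_ge0// => i _; rewrite sqr_ge0.
  rewrite /N2 mulr_sumr ler_sum// => i _.
  apply: le_trans (leK _) _.
  by rewrite mulrCA ler_wpM2l ?AdB// ltW.
have tnorm_le : tnorm g' v <= s * L * tnorm (clairaut g e) v.
  apply: le_trans (ler_wsqrtr main) _.
  rewrite -mulrA sqrtrM ?sqr_ge0// sqrtr_sqr gtr0_norm//.
  by rewrite sqrtrM// mulrA.
apply: le_trans tnorm_le _; rewrite mulrC.
by apply: ler_wpM2l; first exact: sqrtr_ge0.
Qed.
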